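(* For any dotted composition $\alpha=(\alpha_1,\dots,\alpha_l)$, the coproduct of ${\rm sQSym}$ satisfies $$\Delta(M_\alpha)=\sum_{\beta\cdot\gamma=\alpha}M_\beta\otimes M_\gamma=\sum_{k=0}^{l}M_{\alpha_1,\dots,\alpha_k}\otimes M_{\alpha_{k+1},\dots,\alpha_l},$$ where $\beta\cdot\gamma$ denotes concatenation of dotted compositions.
   Context: Variables $x_1,x_2,\dots$ commute; $\theta_1,\theta_2,\dots$ anticommute ($\theta_i\theta_j=-\theta_j\theta_i$, $\theta_i^2=0$). A dotted composition $\alpha=(\alpha_1,\dots,\alpha_l)$ is a finite (possibly empty) sequence whose entries belong to $\{1,2,3,\dots\}$ (non-dotted) or $\{\dot0,\dot1,\dot2,\dots\}$ (dotted). Put $\eta_i=1$ if $\alpha_i$ is dotted and $\eta_i=0$ otherwise. ${\rm sQSym}$ is the $\mathbb Q$-vector space of formal power series $f$ of bounded degree in these variables such that, for every dotted composition $\alpha$, all monomials $\theta_{i_1}^{\eta_1}\cdots\theta_{i_l}^{\eta_l}x_{i_1}^{\alpha_1}\cdots x_{i_l}^{\alpha_l}$ with $i_1<\cdots<i_l$ have the same coefficient in $f$ (dots are ignored in exponents of the $x$'s). It has the basis $M_\alpha=\sum_{i_1<\cdots<i_l}\theta_{i_1}^{\eta_1}\cdots\theta_{i_l}^{\eta_l}x_{i_1}^{\alpha_1}\cdots x_{i_l}^{\alpha_l}$, with $M_\emptyset=1$. ${\rm sQSym}\otimes{\rm sQSym}$ (over $\mathbb Q$) is identified with functions, quasisymmetric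 in each set, of two sets of variables $(x;\theta)$ and $(y;\phi)$, linearly ordered by $x_1<x_2<\cdots<y_1<y_2<\cdots$ and $\theta_1<\theta_2<\cdots<\phi_1<\phi_2<\cdots$, with the $\theta$'s and $\phi$'s anticommuting with each other; $f\otimes g$ corresponds to $f(x;\theta)g(y;\phi)$. The coproduct is $(\Delta f)(x,y;\theta,\phi)=f(x,y;\theta,\phi)$, i.e. $f$ evaluated on the ordered union of the two sets of variables. *)

(* Defs.v *)
From HB Require Import structures.
From mathcomp Require Import all_boot all_order all_algebra finmap.
From mathcomp Require Import boolp classical_sets functions cardinality fsbigop.

Set Implicit Arguments.
Unset Strict Implicit.
Unset Printing Implicit Defensive.

Import Order.TTheory GRing.Theory.

Local Open Scope ring_scope.

(* The part n is encoded by (false, n), where n is positive, and the part n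
   with a dot by (true, n), where n may be zero.  A composition may be empty. *)
Definition dpart := {p : bool * nat | p != (false, 0%N)}.
Definition dcomp := seq dpart.

(* For each letter i of the alphabet I there is a commuting variable x_i and an
   anticommuting variable theta_i.  A monomial is the product of the
   theta_i ^ (m i).1, in increasing order of i, and of the x_i ^ (m i).2. *)
Definition monomial (I : choiceType) := {fsfun I -> bool * nat with (false, 0%N)}.

Section Monomials.
Context {d : Order.disp_t} {I : orderType d}.
Implicit Types (m u v : monomial I) (s : seq I) (al : dcomp).

Definition indices al s := sorted <%O s && (size s == size al).

(* theta_{s_1}^{eta_1} ... theta_{s_l}^{eta_l} x_{s_1}^{al_1} ... x_{s_l}^{al_l},
   meant for [indices al s]. *)
Definition monom al s : monomial I :=
  [fsfun i in [fset j in s]%fset =>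
     nth (false, 0%N) (map val al) (index i s) | (false, 0%N)].

Definition letters m : seq I := sort <=%O (finsupp m).

Definition dshape m : dcomp := pmap insub [seq m i | i <- letters m].

(* Total degree, in the x's and the theta's. *)
Definition degree m : nat := (\sum_(i <- letters m) ((m i).1 + (m i).2))%N.

(* [factors m (u, v)] holds if u v = m up to sign. *)
Definition factors m :=
  [set uv : monomial I * monomial I | forall i, ~~ ((uv.1 i).1 && (uv.2 i).1) /\
     m i = ((uv.1 i).1 || (uv.2 i).1, ((uv.1 i).2 + (uv.2 i).2)%N)]%classic.

(* The number of transpositions needed to sort the theta's of u v. *)
Definition inversions u v : nat :=
  (\sum_(i <- letters u | (u i).1) \sum_(j <- letters v | (v j).1) (j < i)%O)%N.

End Monomials.

Definition series (I : choiceType) := monomial I -> rat^o.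
HB.instance Definition _ (I : choiceType) := GRing.Lmodule.on (series I).

Section Series.
Context {d : Order.disp_t} {I : orderType d}.
Implicit Types f g : series I.

(* Only finitely many pairs contribute, see [finite_factors] below. *)
Definition smul f g : series I := fun m =>
  \sum_(uv \in factors m)
    (-1) ^+ inversions uv.1 uv.2 * f uv.1 * g uv.2.

Definition quasisymmetric f := forall al s t,
  indices al s -> indices al t -> f (monom al s) = f (monom al t).

Definition bounded_degree f := exists n, forall m, f m != 0 -> (degree m <= n)%N.

End Series.

(* The variables are numbered from 0. *)
Definition is_sQSym : {pred series nat} :=
  fun f => `[< quasisymmetric f /\ bounded_degree f >].

Record sQSym := SQSym { sval_of :> series nat; _ : sval_of \in is_sQSym }.

(* The coefficientwise sum of the infinite family of monomials of shape al. *)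
Definition Mseries (al : dcomp) : series nat := fun m =>
  \sum_(s \in [set s : seq nat | indices al s]%classic) ((monom al s == m)%:R : rat).

(* (false, i) is the index of x_i and theta_i, and (true, i) that of y_i and
   phi_i; the lexicographic order puts the first set before the second one. *)
Definition alphabet2 := (bool *l nat)%type.

Definition letter (b : bool) (i : nat) : alphabet2 := (b, i).

(* m = part false m (x; theta) part true m (y; phi), see [join_part] below. *)
Definition part (b : bool) (m : monomial alphabet2) : monomial nat :=
  [fsfun i in [fset k.2 | k in finsupp m]%fset => m (letter b i) | (false, 0%N)].

(* u(x; theta) v(y; phi) *)
Definition join (u v : monomial nat) : monomial alphabet2 :=
  [fsfun k in ([fset letter false i | i in finsupp u]
               `|` [fset letter true i | i in finsupp v])%fset =>
     if k.1 then v k.2 else u k.2 | (false, 0%N)].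

(* f(x; theta) if b is false, and f(y; phi) if b is true. *)
Definition in_variables (b : bool) (f : series nat) : series alphabet2 :=
  fun m => if all (fun k => k.1 == b) (finsupp m) then f (part b m) else 0.

Definition biquasisymmetric (f : series alphabet2) :=
  (forall v, quasisymmetric (fun u => f (join u v))) /\
  (forall u, quasisymmetric (fun v => f (join u v))).

Definition is_sQSym2 : {pred series alphabet2} :=
  fun f => `[< biquasisymmetric f /\ bounded_degree f >].

(* sQSym (x) sQSym, identified with the space of the functions of the two sets
   of variables that are quasisymmetric in each set. *)
Record sQSym2 := SQSym2 { sval2_of :> series alphabet2; _ : sval2_of \in is_sQSym2 }.

(* The common coefficient in f of the monomials of shape al. *)
Definition coef_of (f : series nat) (al : dcomp) : rat :=
  f (monom al (iota 0 (size al))).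

(* Evaluation of a quasisymmetric f on an arbitrary ordered alphabet: for
   increasing s, the coefficient of [monom al s] is that of the monomials of
   shape al in f, see [evaluateE] below. *)
Definition evaluate {d : Order.disp_t} (I : orderType d) (f : series nat)
  : series I := fun m => coef_of f (dshape m).
Arguments evaluate {d} I f m.

Section MonomialTheory.
Context {d : Order.disp_t} {I : orderType d}.
Implicit Types (m u v : monomial I) (s : seq I) (al : dcomp).

Lemma letters_sorted m : sorted <%O (letters m).
Proof. by rewrite lt_sorted_uniq_le sort_uniq fset_uniq sort_le_sorted. Qed.

Lemma mem_letters m i : (i \in letters m) = (i \in finsupp m).
Proof. by rewrite mem_sort. Qed.

Lemma map_val_shape m : map val (dshape m) = [seq m i | i <- letters m].
Proof.
have: all (fun i => m i != (false, 0%N)) (letters m).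
  by apply/allP => i; rewrite mem_letters mem_finsupp.
rewrite /dshape; elim: (letters m) => //= i s IHs /andP[mi /IHs].
by rewrite insubT /= => ->.
Qed.

Lemma size_shape m : size (dshape m) = size (letters m).
Proof. by rewrite -(size_map val) map_val_shape size_map. Qed.

Lemma indices_letters m : indices (dshape m) (letters m).
Proof. by rewrite /indices letters_sorted size_shape eqxx. Qed.

Lemma monomE al s i : monom al s i =
  if i \in s then nth (false, 0%N) (map val al) (index i s) else (false, 0%N).
Proof. by rewrite fsfunE inE. Qed.

Lemma finsupp_monom al s : size s = size al -> finsupp (monom al s) =i s.
Proof.
move=> sz i; rewrite mem_finsupp monomE; case: ifPn => [si|]; last by rewrite eqxx.
have lt_i : (index i s < size al)%N by rewrite -sz index_mem.
case: al {sz} lt_i => // p al lt_i.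
by rewrite (nth_map p) ?(valP (nth p _ _)).
Qed.

Lemma letters_monom al s : indices al s -> letters (monom al s) = s.
Proof.
move=> /andP[s_sorted /eqP sz]; apply: lt_sorted_eq; rewrite ?letters_sorted//.
by move=> i; rewrite mem_letters finsupp_monom.
Qed.

Lemma shape_monom al s : indices al s -> dshape (monom al s) = al.
Proof.
move=> als; apply: (inj_map val_inj); rewrite map_val_shape letters_monom //.
have /andP[/lt_sorted_uniq s_uniq /eqP sz] := als.
apply: (@eq_from_nth _ (false, 0%N)); rewrite ?size_map// => i lt_i.
case: s als sz s_uniq lt_i => // j s als sz s_uniq lt_i.
by rewrite (nth_map j)// monomE mem_nth// index_uniq.
Qed.

Lemma monom_letters m : monom (dshape m) (letters m) = m.
Proof.
apply/fsfunP => i; rewrite monomE mem_letters.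
case: finsuppP => // mi; rewrite map_val_shape (nth_map i) ?nth_index//.
  by rewrite mem_letters.
by rewrite index_mem mem_letters.
Qed.

Lemma degreeE m : degree m = (\sum_(p <- dshape m) ((val p).1 + (val p).2))%N.
Proof.
rewrite -(big_map val xpredT (fun p : bool * nat => p.1 + p.2)%N).
by rewrite map_val_shape big_map.
Qed.

Lemma quasisymmetricP (f : series I) :
  quasisymmetric f <-> forall m m', dshape m = dshape m' -> f m = f m'.
Proof.
split=> [qf m m' mm'|qf al s t als alt]; last first.
  by apply: qf; rewrite !shape_monom.
rewrite -[m]monom_letters -[m']monom_letters mm'.
by apply: qf; rewrite -?mm'; [|rewrite mm']; exact: indices_letters.
Qed.

Lemma finite_factors m : finite_set (factors m).
Proof.
pose n := (\sum_(i <- letters m) (m i).2)%N.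
pose G := {ffun finsupp m -> bool * 'I_n.+1}.
pose r (g : G) : monomial I :=
  [fsfun i : finsupp m => ((g i).1, nat_of_ord (g i).2) | (false, 0%N)].
apply: (@sub_finite_set _ _ (range (fun g : G * G => (r g.1, r g.2)))); last first.
  by apply: finite_image; exact: finite_finset.
have low i : ((m i).2 <= n)%N.
  case: finsuppP => // mi; rewrite /n (bigD1_seq i) ?mem_letters ?sort_uniq//=.
  exact: leq_addr.
have lift (u : monomial I) :
    (forall i, ((u i).1 -> (m i).1) /\ ((u i).2 <= (m i).2)%N) ->
    exists g, r g = u.
  move=> um; exists [ffun i => ((u (val i)).1, inord (u (val i)).2)].
  apply/fsfunP => i; rewrite fsfun_ffun; case: insubP => [j _ ji|mi] /=.
    rewrite ffunE /= inordK ?ji ?ltnS; first by case: (u i).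
    by rewrite (leq_trans _ (low i)) //; have [] := um i.
  have := um i; rewrite (fsfun_dflt mi) /=; case: (u i) => [[] [|k]] [] //=.
  by move=> /(_ isT).
move=> [u v] /= uv.
have [|gu <-] := lift u.
  by move=> i; have [_ ->] /= := uv i; split=> [->|]//; exact: leq_addr.
have [|gv <-] := lift v.
  by move=> i; have [_ ->] /= := uv i; split=> [->|]; rewrite ?orbT// leq_addl.
by exists (gu, gv).
Qed.

End MonomialTheory.

Lemma indices_iota (al : dcomp) : indices al (iota 0 (size al)).
Proof. by rewrite /indices size_iota eqxx andbT iota_ltn_sorted. Qed.

Lemma is_sQSymP (f : series nat) :
  reflect (quasisymmetric f /\ bounded_degree f) (f \in is_sQSym).
Proof. exact: asboolP. Qed.

Lemma MseriesE al m : Mseries al m = (dshape m == al)%:R.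
Proof.
rewrite /Mseries; case: eqP => [<-|neq].
  rewrite -(fsbig_widen [set letters m]%classic).
  - by rewrite fsbig_set1 monom_letters eqxx.
  - by move=> _ ->; exact: indices_letters.
  - move=> s [/= als ns]; case: eqP => // e.
    by case: ns; rewrite -e letters_monom.
by rewrite fsbig1// => s als; case: eqP => // e; case: neq; rewrite -e shape_monom.
Qed.

Lemma Mseries_sQSym al : Mseries al \in is_sQSym.
Proof.
apply/is_sQSymP; split.
  by apply/quasisymmetricP => m m' mm'; rewrite !MseriesE mm'.
exists (\sum_(p <- al) ((val p).1 + (val p).2))%N => m.
by rewrite MseriesE; case: (dshape m =P al) => [<-|_ /eqP[]//]; rewrite degreeE.
Qed.

Lemma bounded_degree_submod d (I : orderType d) :
  [/\ bounded_degree (0 : series I),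
      forall f g : series I, bounded_degree f -> bounded_degree g ->
        bounded_degree (f + g)
    & forall (a : rat) (f : series I), bounded_degree f -> bounded_degree (a *: f)].
Proof.
split=> [|f g [a fa] [b gb]|a f [b fb]]; first by exists 0%N => m /eqP[].
  exists (maxn a b) => m; rewrite leq_max => fg.
  case: (eqVneq (f m) 0) => [f0|/fa -> //].
  case: (eqVneq (g m) 0) => [g0|/gb ->]; last by rewrite orbT.
  have fg0 : f m + g m = 0 by rewrite f0 g0 addr0.
  by case/eqP: fg.
exists b => m am; apply: fb; apply: contra_neq am => f0.
have af0 : a *: f m = 0 by rewrite f0 scaler0.
by [].
Qed.

Fact is_sQSym_submod : GRing.submod_closed is_sQSym.
Proof.
have [b0 bD bZ] := bounded_degree_submod nat.
split=> [|a f g /is_sQSymP[qf bf] /is_sQSymP[qg bg]]; apply/is_sQSymP.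
  by split=> // al s t _ _.
split; last by apply: bD => //; exact: bZ.
move=> al s t als alt.
by rewrite ![(a *: f + g) _]/(a * f _ + g _) (qf _ _ _ als alt) (qg _ _ _ als alt).
Qed.
HB.instance Definition _ := GRing.isSubmodClosed.Build rat (series nat) is_sQSym
  is_sQSym_submod.
HB.instance Definition _ := [isSub for sval_of].
HB.instance Definition _ := [Choice of sQSym by <:].
HB.instance Definition _ := [SubChoice_isSubLmodule of sQSym by <:].

Definition M (al : dcomp) : sQSym := SQSym (Mseries_sQSym al).

Section TwoSets.
Implicit Types (u v w : monomial nat) (m : monomial alphabet2).

Lemma fsetK_letter b w k :
  (k \in [fset letter b i | i in finsupp w]%fset) = (k.1 == b) && (k.2 \in finsupp w).
Proof.
apply/imfsetP/andP => [[i iw ->]//=|[/eqP kb kw]]; exists k.2 => //.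
by rewrite /letter -kb; case: k {kb kw}.
Qed.

Lemma joinE u v k : join u v k = if k.1 then v k.2 else u k.2.
Proof.
rewrite fsfunE inE !fsetK_letter; case: k => [[] i] /=.
  by case: finsuppP.
by rewrite orbF; case: finsuppP.
Qed.

Lemma partE b m i : part b m i = m (letter b i).
Proof.
rewrite fsfunE; case: ifPn => // /imfsetP mi; case: finsuppP => // im.
by case: mi; exists (letter b i).
Qed.

Lemma part_join b u v : part b (join u v) = if b then v else u.
Proof. by apply/fsfunP => i; rewrite partE joinE; case: b. Qed.

Lemma join_part m : join (part false m) (part true m) = m.
Proof. by apply/fsfunP => -[[] i]; rewrite joinE /= partE. Qed.

Lemma letters_join u v :
  letters (join u v) = map (letter false) (letters u) ++ map (letter true) (letters v).
Proof.
apply: lt_sorted_eq; first exact: letters_sorted.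
  have mono b : {homo letter b : i j / (i < j)%O} by case: b => i j ij; exact: ij.
  rewrite lt_sorted_pairwise pairwise_cat -!lt_sorted_pairwise.
  rewrite !(homo_sorted (@mono _)) ?letters_sorted// !andbT.
  by apply/allrelP => _ _ /mapP[i _ ->] /mapP[j _ ->]; rewrite ltxi_pair.
move=> k; rewrite mem_letters mem_finsupp mem_cat joinE.
have memE b w : (k \in map (letter b) (letters w)) = (k.1 == b) && (k.2 \in finsupp w).
  rewrite -fsetK_letter; apply/mapP/imfsetP => -[i iw ->]; exists i => //.
    by rewrite mem_letters in iw.
  by rewrite mem_letters.
by rewrite !memE; case: k {memE} => [[] i]; rewrite /= ?orbF mem_finsupp.
Qed.

Lemma shape_join u v : dshape (join u v) = dshape u ++ dshape v.
Proof.
apply: (inj_map val_inj); rewrite map_cat !map_val_shape letters_join map_cat.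
by rewrite -!map_comp; congr (_ ++ _); apply: eq_map => i; rewrite /= joinE.
Qed.

Lemma shape_part m : dshape m = dshape (part false m) ++ dshape (part true m).
Proof. by rewrite -{1}[m]join_part shape_join. Qed.

Lemma degree_part m : degree m = (degree (part false m) + degree (part true m))%N.
Proof. by rewrite !degreeE shape_part big_cat. Qed.

Lemma tensE (f g : series nat) m :
  smul (in_variables false f) (in_variables true g) m =
  f (part false m) * g (part true m).
Proof.
pose w0 : monomial nat := [fsfun with (false, 0%N)].
pose u0 := join (part false m) w0; pose v0 := join w0 (part true m).
have w0E i : w0 i = (false, 0%N) by rewrite fsfun0E.
have onlyP b (w : monomial alphabet2) : all (fun k => k.1 == b) (finsupp w) ->
    forall k, k.1 != b -> w k = (false, 0%N).
  by move=> /allP wb k; apply: contraNeq; rewrite -mem_finsupp => /wb.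
have u0b : all (fun k => k.1 == false) (finsupp u0).
  by apply/allP => -[[] i]; rewrite mem_finsupp joinE //= w0E eqxx.
have v0b : all (fun k => k.1 == true) (finsupp v0).
  by apply/allP => -[[] i]; rewrite mem_finsupp joinE //= w0E eqxx.
rewrite /smul -(fsbig_widen [set (u0, v0)]%classic).
- rewrite fsbig_set1 /= /in_variables u0b v0b !part_join.
  suff -> : inversions u0 v0 = 0%N by rewrite expr0 mul1r.
  rewrite /inversions big_seq_cond big1// => i /andP[iu _].
  rewrite big_seq_cond big1// => j /andP[jv _].
  move: iu jv; rewrite !mem_letters => /(allP u0b) iu /(allP v0b) jv.
  by case: i j iu jv => [[] i] [[] j].
- move=> _ -> k /=; rewrite !joinE; case: k => [[] i] /=; rewrite w0E /= !partE.
    by rewrite -surjective_pairing.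
  by rewrite andbF orbF addn0 -surjective_pairing.
- move=> [u v] [/= uv ne]; rewrite /in_variables.
  case: ifPn => ub; last by rewrite mulr0 mul0r.
  case: ifPn => vb; last by rewrite mulr0.
  case: ne; congr (_, _); apply/fsfunP => -[[] i]; rewrite joinE /= ?w0E ?partE.
  + exact: onlyP ub _ _.
  + have [_ ->] := uv (letter false i).
    rewrite (onlyP _ _ vb (letter false i))//= orbF addn0.
    exact: surjective_pairing.
  + have [_ ->] := uv (letter true i).
    rewrite (onlyP _ _ ub (letter true i))//= .
    exact: surjective_pairing.
  + exact: onlyP vb _ _.
Qed.

End TwoSets.

Lemma is_sQSym2P (f : series alphabet2) :
  reflect (biquasisymmetric f /\ bounded_degree f) (f \in is_sQSym2).
Proof. exact: asboolP. Qed.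

Fact is_sQSym2_submod : GRing.submod_closed is_sQSym2.
Proof.
have [b0 bD bZ] := bounded_degree_submod alphabet2.
split=> [|a f g /is_sQSym2P[[qf qf'] bf] /is_sQSym2P[[qg qg'] bg]]; apply/is_sQSym2P.
  by split=> //; split=> w al s t _ _.
split; last by apply: bD => //; exact: bZ.
by split=> w al s t als alt; rewrite ![(a *: f + g) _]/(a * f _ + g _);
  rewrite ?(qf w _ _ _ als alt) ?(qg w _ _ _ als alt)
          ?(qf' w _ _ _ als alt) ?(qg' w _ _ _ als alt).
Qed.
HB.instance Definition _ :=
  GRing.isSubmodClosed.Build rat (series alphabet2) is_sQSym2 is_sQSym2_submod.
HB.instance Definition _ := [isSub for sval2_of].
HB.instance Definition _ := [Choice of sQSym2 by <:].
HB.instance Definition _ := [SubChoice_isSubLmodule of sQSym2 by <:].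

Lemma tens_sQSym2 (f g : sQSym) :
  smul (in_variables false f) (in_variables true g) \in is_sQSym2.
Proof.
case: f g => [f /= /is_sQSymP[qf [a fa]]] [g /= /is_sQSymP[qg [b gb]]].
apply/is_sQSym2P; split.
  split=> w al s t als alt; rewrite !tensE !part_join.
    by rewrite (qf _ _ _ als alt).
  by rewrite (qg _ _ _ als alt).
exists (a + b)%N => m; rewrite tensE mulf_eq0 negb_or => /andP[/fa da /gb db].
by rewrite degree_part leq_add.
Qed.

(* f (x) g is identified with f(x; theta) g(y; phi). *)
Definition tens (f g : sQSym) : sQSym2 := SQSym2 (tens_sQSym2 f g).

Lemma evaluateE d (I : orderType d) (f : sQSym) al (s : seq I) (t : seq nat) :
  indices al s -> indices al t -> evaluate I f (monom al s) = sval_of f (monom al t).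
Proof.
case: f => f /= /is_sQSymP[qf _] als alt.
by rewrite /evaluate shape_monom//; apply: qf; rewrite ?indices_iota.
Qed.

Lemma Delta_sQSym2 (f : sQSym) : evaluate alphabet2 f \in is_sQSym2.
Proof.
case: f => f /= /is_sQSymP[qf [n fn]]; apply/is_sQSym2P; split.
  by split=> w al s t als alt; rewrite /evaluate !shape_join !shape_monom.
exists n => m /fn; rewrite !degreeE shape_monom//; exact: indices_iota.
Qed.

Definition Delta (f : sQSym) : sQSym2 := SQSym2 (Delta_sQSym2 f).

(* Main.v *)
(* Evaluated on the ordered union of two alphabets, the coefficient of a monomial
   u(x; theta) v(y; phi) in M_alpha is 1 if the shape of u followed by the shape
   of v is alpha, and 0 otherwise.  If it is alpha, then the size of the shape of
   u is the only k at which M_{take k alpha} (x) M_{drop k alpha} contains u v. *)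
Require Import Defs.
From mathcomp Require Import all_boot all_order all_algebra finmap.
From mathcomp Require Import boolp classical_sets functions cardinality fsbigop.

Local Open Scope ring_scope.

Import GRing.Theory.

(** A factorisation of [s] is determined by the length of its first factor, so cutting at [k] is a
    bijection from [k <= size s] onto the index set on the left, which is therefore finite. *)
Lemma fsbig_cat_eq (T : choiceType) (V : nmodType) (s : seq T)
    (F : seq T * seq T -> V) :
  \sum_(bg \in [set bg : seq T * seq T | bg.1 ++ bg.2 = s]%classic) F bg =
  \sum_(0 <= k < (size s).+1) F (take k s, drop k s).
Proof.
rewrite big_mkord (fsbig_ord _ _ (fun k => F (take k s, drop k s))).
apply: (reindex_fsbig (fun k => (take k s, drop k s))); split.
- by move=> k _ /=; rewrite cat_take_drop.
(* The bound matters: every cut beyond [size s] would give the same pair [(s, [::])]. *)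
- move=> j k; rewrite !inE /= !ltnS => js ks [/(congr1 size)].
  by rewrite !size_takel.
- move=> [b g] /= <-; exists (size b); last by rewrite take_size_cat // drop_size_cat.
  by rewrite /= ltnS size_cat leq_addr.
Qed.

(** Used with [p] and [q] the shapes of the two parts of a monomial. *)
Lemma sum_take_drop_eq (T : eqType) (R : pzSemiRingType) (p q s : seq T) :
  \sum_(0 <= k < (size s).+1) (p == take k s)%:R * (q == drop k s)%:R =
  (p ++ q == s)%:R :> R.
Proof.
rewrite big_mkord; case: eqP => [<-|ne].
  have lt_p : (size p < (size (p ++ q)).+1)%N by rewrite ltnS size_cat leq_addr.
  rewrite (bigD1 (Ordinal lt_p)) //= take_size_cat // drop_size_cat // !eqxx mulr1.
  (* A nonzero term makes [p] the prefix of length [k], so [k = size p]. *)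
  rewrite big1 ?addr0 // => k; apply: contraNeq; rewrite -val_eqE /=.
  case: (p =P take k _) => [/(congr1 size) pk _|_]; last by rewrite mul0r eqxx.
  by rewrite pk size_takel // -ltnS.
rewrite big1 // => k _; case: eqP => [pk|]; last by rewrite mul0r.
case: eqP => [qk|]; last by rewrite mulr0.
by case: ne; rewrite pk qk cat_take_drop.
Qed.

Lemma DeltaE (al : dcomp) (m : monomial alphabet2) :
  sval2_of (Delta (M al)) m = (dshape m == al)%:R.
Proof.
(* The coefficient is read at the representative monomial on the first letters, whose shape is again
   [dshape m]. *)
by rewrite /= /evaluate /coef_of /= MseriesE shape_monom // indices_iota.
Qed.

Lemma tens_ME (be ga : dcomp) (m : monomial alphabet2) :
  sval2_of (tens (M be) (M ga)) m =
  (dshape (part false m) == be)%:R * (dshape (part true m) == ga)%:R.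
Proof. by rewrite /= tensE !MseriesE. Qed.

Lemma sval2_of_sum (I : Type) (r : seq I) (F : I -> sQSym2)
    (m : monomial alphabet2) :
  sval2_of (\sum_(i <- r) F i) m = \sum_(i <- r) sval2_of (F i) m.
Proof. by elim/big_rec2: _ => //= i x f _ <-. Qed.

Lemma Delta_M (al : dcomp) :
  Delta (M al) =
    \sum_(0 <= k < (size al).+1) tens (M (take k al)) (M (drop k al)).
Proof.
apply: val_inj; apply: funext => m /=.
rewrite -[LHS]/(sval2_of (Delta (M al)) m) DeltaE sval2_of_sum.
under eq_bigr do rewrite tens_ME.
by rewrite sum_take_drop_eq -shape_part.
Qed.

Theorem proposition5p7 (alpha : dcomp) :
  Delta (M alpha) =
    \sum_(bg \in [set bg : dcomp * dcomp | bg.1 ++ bg.2 = alpha]%classic)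
      tens (M bg.1) (M bg.2)
  /\
  \sum_(bg \in [set bg : dcomp * dcomp | bg.1 ++ bg.2 = alpha]%classic)
      tens (M bg.1) (M bg.2) =
    \sum_(0 <= k < (size alpha).+1) tens (M (take k alpha)) (M (drop k alpha)).
Proof. by rewrite Delta_M fsbig_cat_eq. Qed.
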